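(* Let $(H,\beta)$ be a Hom-Hopf algebra over a field $K$ with bijective antipode $S$. Then the category ${}_H^H\mathbb{YD}$ of (left-left) Hom-Yetter-Drinfeld modules over $(H,\beta)$ is a braided tensor category with the following data, for objects $M,N,P$: - tensor product: $M\otimes N$ with automorphism $\alpha_M\otimes\alpha_N$, action $h\rhd_{M\otimes N}(m\otimes n)=(h_1\rhd_M m)\otimes(h_2\rhd_N n)$ and coaction $\rho^{M\otimes N}(m\otimes n)=\beta^{-2}(m_{-1}n_{-1})\otimes m_0\otimes n_0$; - associativity constraints: $a_{M,N,P}:(M\otimes N)\otimes P\to M\otimes(N\otimes P)$, $(m\otimes n)\otimes p\mapsto\alpha_M^{-1}(m)\otimes(n\otimes\alpha_P(p))$; - braiding: $c_{M,N}:M\otimes N\to N\otimes M$, $m\otimes n\mapsto(\beta^2(m_{-1})\rhd_N\alpha_N^{-1}(n))\otimes\alpha_M^{-1}(m_0)$; - unit object: $I=(K,\mathrm{id}_K)$ with action $h\otimes k\mapsto\varepsilon(h)k$ and coaction $k\mapsto1_H\otimes k$.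
   Context: All spaces are over a field $K$. Sweedler-type notation: $\Delta(c)=c_1\otimes c_2$, $\Delta(c_1)=c_{11}\otimes c_{12}$, etc., summation understood. Hom-algebra $(A,\mu,1_A,\alpha)$ (abbr. $(A,\alpha)$): a vector space $A$, a linear map $\mu:A\otimes A\to A$, $a\otimes a'\mapsto aa'$, an element $1_A\in A$ and a bijective linear map $\alpha:A\to A$ with $\alpha(aa')=\alpha(a)\alpha(a')$, $\alpha(1_A)=1_A$, $\alpha(a)(a'a'')=(aa')\alpha(a'')$, $a1_A=1_Aa=\alpha(a)$. Hom-coalgebra $(C,\Delta,\varepsilon_C,\beta)$ (abbr. $(C,\beta)$): a vector space $C$, linear maps $\Delta:C\to C\otimes C$, $\varepsilon_C:C\to K$ and a bijective linear map $\beta:C\to C$ with $\Delta(\beta(c))=\beta(c_1)\otimes\beta(c_2)$, $\varepsilon_C\circ\beta=\varepsilon_C$, $\beta(c_1)\otimes c_{21}\otimes c_{22}=c_{11}\otimes c_{12}\otimes\beta(c_2)$, $\varepsilon_C(c_1)c_2=c_1\varepsilon_C(c_2)=\beta(c)$. Hom-bialgebra $(H,\mu,1_H,\Delta,\varepsilon,\beta)$ (abbr. $(H,\beta)$): $(H,\mu,1_H,\beta)$ is a Hom-algebra, $(H,\Delta,\varepsilon,\beta)$ is a Hom-coalgebra, and $\Delta(hh')=h_1h'_1\otimes h_2h'_2$, $\Delta(1_H)=1_H\otimes1_H$, $\varepsilon(hh')=\varepsilon(h)\varepsilon(h')$, $\varepsilon(1_H)=1$. A Hom-Hopf algebra $(H,\beta,S)$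 is a Hom-bialgebra with a linear map $S:H\to H$ (antipode) such that $S(h_1)h_2=h_1S(h_2)=\varepsilon(h)1_H$ and $S(\beta(h))=\beta(S(h))$. Left $(H,\beta)$-Hom-module $(M,\rhd,\alpha)$ over a Hom-algebra $(H,\beta)$: a vector space $M$, a linear map $\rhd:H\otimes M\to M$ and a bijective linear map $\alpha:M\to M$ with $\alpha(h\rhd m)=\beta(h)\rhd\alpha(m)$, $\beta(h)\rhd(h'\rhd m)=(hh')\rhd\alpha(m)$, $1_H\rhd m=\alpha(m)$. A morphism of left Hom-modules $f:M\to N$ is a linear map with $f(h\rhd_M m)=h\rhd_N f(m)$ and $\alpha_N\circ f=f\circ\alpha_M$. Left $(H,\beta)$-Hom-comodule $(M,\rho,\alpha)$ over a Hom-coalgebra $(H,\beta)$: a vector space $M$, a linear map $\rho:M\to H\otimes M$, $\rho(m)=m_{-1}\otimes m_0$, and a bijective linear map $\alpha:M\to M$ with $\rho(\alpha(m))=\beta(m_{-1})\otimes\alpha(m_0)$, $\beta(m_{-1})\otimes m_{0\,-1}\otimes m_{0\,0}=m_{-1\,1}\otimes m_{-1\,2}\otimes\alpha(m_0)$, $\varepsilon(m_{-1})m_0=\alpha(m)$. A morphism of left Hom-comodules $f:M\to N$ is a linear map with $f(m)_{-1}\otimes f(m)_0=m_{-1}\otimes f(m_0)$ and $\alpha_N\circ f=f\circ\alpha_M$. (Left-left) Hom-Yetter-Drinfeld module over a Hom-bialgebra $(H,\beta)$: a quadruple $(M,\rhd_M,\rho^M,\alpha_M)$ such that $(M,\rhd_M,\alpha_M)$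 is a left $(H,\beta)$-Hom-module, $(M,\rho^M,\alpha_M)$ is a left $(H,\beta)$-Hom-comodule, and for all $h\in H$, $m\in M$ $$h_1\beta(m_{-1})\otimes(\beta^3(h_2)\rhd_M m_0)=(\beta^2(h_1)\rhd_M m)_{-1}h_2\otimes(\beta^2(h_1)\rhd_M m)_0 .$$ The category ${}_H^H\mathbb{YD}$ has these as objects; its morphisms are the linear maps that are both morphisms of left $(H,\beta)$-Hom-modules and of left $(H,\beta)$-Hom-comodules. The tensor product of morphisms is the tensor product of linear maps. A braided tensor category is a (not necessarily strict) monoidal category with a natural isomorphism $c_{M,N}:M\otimes N\to N\otimes M$ satisfying the two hexagon axioms. The (left and right) unit constraints are not prescribed explicitly; the assertion is that together with the listed data there are unit constraints for $I$ making ${}_H^H\mathbb{YD}$ a monoidal category. *)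

(* Defs.v *)
From HB Require Import structures.
From mathcomp Require Import all_boot all_algebra generic_quotient sesquilinear.
From mathcomp Require Import boolp classical_sets functions.

Set Implicit Arguments.
Unset Strict Implicit.
Unset Printing Implicit Defensive.

Import GRing.Theory.
Local Open Scope ring_scope.
Local Open Scope quotient_scope.

Notation bilinear_map f := (bilinear_for *:%R *:%R f).

Section LinearMap.
Context (K : fieldType) (V W : lmodType K).

Lemma linear_map0 (f : V -> W) : linear f -> f 0 = 0.
Proof. by move=> lf; have := lf (-1) 0 0; rewrite !scaleN1r !addNr. Qed.

Lemma linear_mapD (f : V -> W) : linear f -> {morph f : x y / x + y}.
Proof. by move=> lf x y; have := lf 1 x y; rewrite !scale1r. Qed.

Lemma linear_mapZ (f : V -> W) c x : linear f -> f (c *: x) = c *: f x.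
Proof.
by move=> lf; have := lf c x 0; rewrite !addr0 (linear_map0 lf) addr0.
Qed.

End LinearMap.

(** * Tensor product of two vector spaces

   A tensor is a formal sum of pairs [(a, b)], given as a finite sequence; two
   formal sums are identified when every bilinear map gives them the same
   value.  [tsum_linear], [tsum_tens] and [tensor_ext] below are the universal
   property. *)

Section Tensor.
Context (K : fieldType) (A B : lmodType K).

Definition fsum (W : lmodType K) (f : A -> B -> W) (s : seq (A * B)) : W :=
  \sum_(p <- s) f p.1 p.2.

Definition tensor_eq (s t : seq (A * B)) : bool :=
  `[< forall (W : lmodType K) (f : A -> B -> W),
        bilinear_map f -> fsum f s = fsum f t >].

Lemma tensor_eq_refl : reflexive tensor_eq.
Proof. by move=> s; apply/asboolP. Qed.

Lemma tensor_eq_sym : symmetric tensor_eq.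
Proof.
by move=> s t; apply/asboolP/asboolP => e W f bf; rewrite (e _ _ bf).
Qed.

Lemma tensor_eq_trans : transitive tensor_eq.
Proof.
move=> t s u /asboolP e1 /asboolP e2; apply/asboolP => W f bf.
by rewrite (e1 _ _ bf) (e2 _ _ bf).
Qed.

Canonical tensor_equiv :=
  EquivRel tensor_eq tensor_eq_refl tensor_eq_sym tensor_eq_trans.

Definition tensor := {eq_quot tensor_eq}.
HB.instance Definition _ : EqQuotient _ tensor_eq tensor :=
  EqQuotient.on tensor.
HB.instance Definition _ := Choice.on tensor.

Definition tens (a : A) (b : B) : tensor := \pi_tensor [:: (a, b)].

(* [tsum t f] is "f(t_1, t_2), summation understood": it is computed on a
   chosen representative of [t], and is independent of it as soon as [f] is
   bilinear. *)
Definition tsum (t : tensor) (W : lmodType K) (f : A -> B -> W) : W :=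
  fsum f (repr t).

Lemma tsum_pi (W : lmodType K) (f : A -> B -> W) (s : seq (A * B)) :
  bilinear_map f -> tsum (\pi_tensor s) f = fsum f s.
Proof.
move=> bf; rewrite /tsum.
have /eqmodP /asboolP : repr (\pi_tensor s) = s %[mod tensor].
  by rewrite reprK.
by apply.
Qed.

Lemma tensor_pi_eq (s t : seq (A * B)) :
  (forall (W : lmodType K) (f : A -> B -> W),
     bilinear_map f -> fsum f s = fsum f t) -> \pi_tensor s = \pi_tensor t.
Proof. by move=> e; apply/eqmodP/asboolP. Qed.

Lemma tensor_tsum_eq (t u : tensor) :
  (forall (W : lmodType K) (f : A -> B -> W),
     bilinear_map f -> tsum t f = tsum u f) -> t = u.
Proof. by move=> e; rewrite -[t]reprK -[u]reprK; apply: tensor_pi_eq. Qed.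

Definition scale_seq (c : K) (s : seq (A * B)) : seq (A * B) :=
  [seq (c *: p.1, p.2) | p <- s].

Lemma fsum_cat (W : lmodType K) (f : A -> B -> W) s t :
  fsum f (s ++ t) = fsum f s + fsum f t.
Proof. exact: big_cat. Qed.

Lemma fsum_scale (W : lmodType K) (f : A -> B -> W) c s :
  bilinear_map f -> fsum f (scale_seq c s) = c *: fsum f s.
Proof.
case=> fl _; rewrite /fsum big_map scaler_sumr; apply: eq_bigr => p _ /=.
exact: (linear_mapZ c p.1 (fl p.2)).
Qed.

Definition tensor_zero : tensor := \pi_tensor [::].
Definition tensor_add (t u : tensor) : tensor := \pi_tensor (repr t ++ repr u).
Definition tensor_scale (c : K) (t : tensor) : tensor :=
  \pi_tensor (scale_seq c (repr t)).

Lemma tsum0 (W : lmodType K) (f : A -> B -> W) :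
  bilinear_map f -> tsum tensor_zero f = 0.
Proof. by move=> bf; rewrite tsum_pi // /fsum big_nil. Qed.

Lemma tsumD (W : lmodType K) (f : A -> B -> W) t u :
  bilinear_map f -> tsum (tensor_add t u) f = tsum t f + tsum u f.
Proof. by move=> bf; rewrite tsum_pi // fsum_cat. Qed.

Lemma tsumZ (W : lmodType K) (f : A -> B -> W) c t :
  bilinear_map f -> tsum (tensor_scale c t) f = c *: tsum t f.
Proof. by move=> bf; rewrite tsum_pi // fsum_scale. Qed.

Lemma tensor_addA : associative tensor_add.
Proof.
by move=> t u v; apply: tensor_tsum_eq => W f bf; rewrite !tsumD // addrA.
Qed.

Lemma tensor_addC : commutative tensor_add.
Proof.
by move=> t u; apply: tensor_tsum_eq => W f bf; rewrite !tsumD // addrC.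
Qed.

Lemma tensor_add0 : left_id tensor_zero tensor_add.
Proof.
move=> t; apply: tensor_tsum_eq => W f bf.
by rewrite tsumD // tsum0 // add0r.
Qed.

Lemma tensor_addN : left_inverse tensor_zero (tensor_scale (-1)) tensor_add.
Proof.
move=> t; apply: tensor_tsum_eq => W f bf.
by rewrite tsumD // tsumZ // tsum0 // scaleN1r addNr.
Qed.

HB.instance Definition _ :=
  GRing.isZmodule.Build tensor tensor_addA tensor_addC tensor_add0 tensor_addN.

Lemma tensor_scaleA c d t :
  tensor_scale c (tensor_scale d t) = tensor_scale (c * d) t.
Proof. by apply: tensor_tsum_eq => W f bf; rewrite !tsumZ // scalerA. Qed.

Lemma tensor_scale1 : left_id 1 tensor_scale.
Proof.
by move=> t; apply: tensor_tsum_eq => W f bf; rewrite tsumZ // scale1r.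
Qed.

Lemma tensor_scaleDr : right_distributive tensor_scale +%R.
Proof.
move=> c t u; apply: tensor_tsum_eq => W f bf.
by rewrite tsumZ // !tsumD // !tsumZ // scalerDr.
Qed.

Lemma tensor_scaleDl t : {morph tensor_scale^~ t : c d / c + d}.
Proof.
move=> c d; apply: tensor_tsum_eq => W f bf.
by rewrite tsumZ // tsumD // !tsumZ // scalerDl.
Qed.

HB.instance Definition _ :=
  GRing.Zmodule_isLmodule.Build K tensor
    tensor_scaleA tensor_scale1 tensor_scaleDr tensor_scaleDl.

Lemma tens_bilinear : bilinear_map tens.
Proof.
split=> [b c a a'|a c b b']; apply: tensor_tsum_eq => W f bf;
  rewrite tsumD // tsumZ // !tsum_pi // /fsum !big_seq1 /=.
  exact: bf.1.
exact: bf.2.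
Qed.

Lemma tsum_linear (W : lmodType K) (f : A -> B -> W) :
  bilinear_map f -> linear (fun t => tsum t f).
Proof. by move=> bf c t u; rewrite tsumD // tsumZ. Qed.

Lemma tsum_tens (W : lmodType K) (f : A -> B -> W) a b :
  bilinear_map f -> tsum (tens a b) f = f a b.
Proof. by move=> bf; rewrite tsum_pi // /fsum big_seq1. Qed.

Lemma tensorE (t : tensor) : t = \sum_(p <- repr t) tens p.1 p.2.
Proof.
apply: tensor_tsum_eq => W f bf; rewrite {1}/tsum /fsum.
elim: (repr t) => [|p s IHs]; first by rewrite !big_nil tsum0.
by rewrite !big_cons tsumD // -IHs tsum_tens.
Qed.

Lemma tensor_ext (W : lmodType K) (f g : tensor -> W) :
  linear f -> linear g ->
  (forall a b, f (tens a b) = g (tens a b)) -> f =1 g.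
Proof.
move=> lf lg e t; rewrite [t]tensorE.
elim: (repr t) => [|p s IHs]; first by rewrite !big_nil !linear_map0.
by rewrite !big_cons !linear_mapD // IHs e.
Qed.

End Tensor.

Arguments tens {K A B}.
Arguments tsum {K A B} t {W} f.

Notation "a ⊗ b" := (tens a b) (at level 40, left associativity) : ring_scope.
Notation "\tsum_ ( x ⊗ y <- t ) E" := (tsum t (fun x y => E))
  (at level 41, x name, y name, t at level 39, E at level 41,
   format "\tsum_ ( x  ⊗  y  <-  t )  E") : ring_scope.

Definition inv_map (V : zmodType) (f : V -> V) : V -> V :=
  'pinv_(fun=> 0) [set: V] f.

Lemma inv_mapK (V : zmodType) (f : V -> V) :
  bijective f -> cancel f (inv_map f).
Proof.
move=> /bij_inj f_inj x.
by rewrite /inv_map pinvKV ?in_setT // => y z _ _ /f_inj.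
Qed.

Lemma inv_mapKV (V : zmodType) (f : V -> V) :
  bijective f -> cancel (inv_map f) f.
Proof.
by move=> f_bij x; have [g _ gK] := f_bij; rewrite -[x]gK inv_mapK.
Qed.

(** * Hom-algebras, Hom-coalgebras, Hom-bialgebras, Hom-Hopf algebras

   A linear map out of a tensor product of two spaces is given as a bilinear
   map.  Threefold tensors such as [c_1 ⊗ c_21 ⊗ c_22] are bracketed to the
   right. *)

Record is_hom_algebra (K : fieldType) (A : lmodType K)
    (mul : A -> A -> A) (one : A) (alpha : A -> A) : Prop := IsHomAlgebra {
  hmul_bilinear : bilinear_map mul;
  halg_linear : linear alpha;
  halg_bij : bijective alpha;
  halgM : forall a b, alpha (mul a b) = mul (alpha a) (alpha b);
  halg1 : alpha one = one;
  hmulA : forall a b c, mul (alpha a) (mul b c) = mul (mul a b) (alpha c);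
  hmul1r : forall a, mul a one = alpha a;
  hmul1l : forall a, mul one a = alpha a
}.

Record is_hom_coalgebra (K : fieldType) (C : lmodType K)
    (Delta : C -> tensor C C) (eps : C -> K) (beta : C -> C) : Prop :=
    IsHomCoalgebra {
  Delta_linear : linear Delta;
  eps_linear : scalar eps;
  hcoalg_linear : linear beta;
  hcoalg_bij : bijective beta;
  Delta_beta : forall c,
    Delta (beta c) = \tsum_(c1 ⊗ c2 <- Delta c) beta c1 ⊗ beta c2;
  eps_beta : forall c, eps (beta c) = eps c;
  Delta_coassoc : forall c,
    \tsum_(c1 ⊗ c2 <- Delta c)
      \tsum_(c21 ⊗ c22 <- Delta c2) beta c1 ⊗ (c21 ⊗ c22) =
    \tsum_(c1 ⊗ c2 <- Delta c)
      \tsum_(c11 ⊗ c12 <- Delta c1) c11 ⊗ (c12 ⊗ beta c2);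
  eps_counitl : forall c, \tsum_(c1 ⊗ c2 <- Delta c) eps c1 *: c2 = beta c;
  eps_counitr : forall c, \tsum_(c1 ⊗ c2 <- Delta c) eps c2 *: c1 = beta c
}.

Record homBialgebra (K : fieldType) := HomBialgebra {
  hsort :> lmodType K;
  hmul : hsort -> hsort -> hsort;
  hone : hsort;
  hDelta : hsort -> tensor hsort hsort;
  heps : hsort -> K;
  hbeta : hsort -> hsort;
  hbialg_alg : is_hom_algebra hmul hone hbeta;
  hbialg_coalg : is_hom_coalgebra hDelta heps hbeta;
  hDeltaM : forall h k : hsort,
    hDelta (hmul h k) =
    \tsum_(h1 ⊗ h2 <- hDelta h)
      \tsum_(k1 ⊗ k2 <- hDelta k) hmul h1 k1 ⊗ hmul h2 k2;
  hDelta1 : hDelta hone = hone ⊗ hone;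
  hepsM : forall h k : hsort, heps (hmul h k) = heps h * heps k;
  heps1 : heps hone = 1
}.

Arguments hone {K H} : rename.

Record homHopfAlgebra (K : fieldType) := HomHopfAlgebra {
  hopf_bialg :> homBialgebra K;
  antipode : hopf_bialg -> hopf_bialg;
  antipode_linear : linear antipode;
  antipodel : forall h,
    \tsum_(h1 ⊗ h2 <- hDelta h) hmul (antipode h1) h2 = heps h *: hone;
  antipoder : forall h,
    \tsum_(h1 ⊗ h2 <- hDelta h) hmul h1 (antipode h2) = heps h *: hone;
  antipode_beta : forall h, antipode (hbeta h) = hbeta (antipode h)
}.

(** * Hom-modules, Hom-comodules and Hom-Yetter-Drinfeld modules *)

Section YetterDrinfeld.
Context (K : fieldType) (H : homBialgebra K).

Record is_hom_module (M : lmodType K) (act : H -> M -> M) (alpha : M -> M) :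
    Prop := IsHomModule {
  act_bilinear : bilinear_map act;
  hmod_linear : linear alpha;
  hmod_bij : bijective alpha;
  alpha_act : forall h m, alpha (act h m) = act (hbeta h) (alpha m);
  act_assoc : forall h k m,
    act (hbeta h) (act k m) = act (hmul h k) (alpha m);
  act1 : forall m, act hone m = alpha m
}.

Record is_hom_comodule (M : lmodType K) (coact : M -> tensor H M)
    (alpha : M -> M) : Prop := IsHomComodule {
  coact_linear : linear coact;
  hcomod_linear : linear alpha;
  hcomod_bij : bijective alpha;
  coact_alpha : forall m,
    coact (alpha m) = \tsum_(x ⊗ m0 <- coact m) hbeta x ⊗ alpha m0;
  coact_coassoc : forall m,
    \tsum_(x ⊗ m0 <- coact m)
      \tsum_(y ⊗ m00 <- coact m0) hbeta x ⊗ (y ⊗ m00) =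
    \tsum_(x ⊗ m0 <- coact m)
      \tsum_(x1 ⊗ x2 <- hDelta x) x1 ⊗ (x2 ⊗ alpha m0);
  coact_counit : forall m, \tsum_(x ⊗ m0 <- coact m) heps x *: m0 = alpha m
}.

Record ydData := YDData {
  yd_sort :> lmodType K;
  yd_act : H -> yd_sort -> yd_sort;
  yd_coact : yd_sort -> tensor H yd_sort;
  yd_alpha : yd_sort -> yd_sort
}.

Record is_yd (M : ydData) : Prop := IsYD {
  yd_module : is_hom_module (@yd_act M) (@yd_alpha M);
  yd_comodule : is_hom_comodule (@yd_coact M) (@yd_alpha M);
  yd_compat : forall (h : H) (m : M),
    \tsum_(h1 ⊗ h2 <- hDelta h)
      \tsum_(x ⊗ m0 <- yd_coact m)
        hmul h1 (hbeta x) ⊗ yd_act (iter 3 (@hbeta K H) h2) m0 =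
    \tsum_(h1 ⊗ h2 <- hDelta h)
      \tsum_(x ⊗ n0 <- yd_coact (yd_act (iter 2 (@hbeta K H) h1) m))
        hmul x h2 ⊗ n0
}.

Record ydModule := YDModule {
  yd_data :> ydData;
  ydP : is_yd yd_data
}.

Record is_yd_morphism (M N : ydData) (f : M -> N) : Prop := IsYDMorphism {
  ydhom_linear : linear f;
  ydhom_act : forall (h : H) m, f (yd_act h m) = yd_act h (f m);
  ydhom_coact : forall m,
    yd_coact (f m) = \tsum_(x ⊗ m0 <- yd_coact m) x ⊗ f m0;
  ydhom_alpha : forall m, yd_alpha (f m) = f (yd_alpha m)
}.

Record ydHom (M N : ydModule) := YDHom {
  ydhom_fun :> M -> N;
  ydhomP : is_yd_morphism ydhom_fun
}.

Lemma ydHom_ext (M N : ydModule) (f g : ydHom M N) : f =1 g -> f = g.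
Proof.
case: f g => [f fP] [g gP] /= /funext e; case: g / e gP => gP.
by rewrite (Prop_irrelevance fP gP).
Qed.

End YetterDrinfeld.

Arguments yd_act {K H M} : rename.
Arguments yd_coact {K H M} : rename.
Arguments yd_alpha {K H M} : rename.

Section LinearTsum.
Context (K : fieldType).
Implicit Types U V W : lmodType K.

Lemma linear_tsum U V W W' (g : W -> W') (t : tensor U V) (f : U -> V -> W) :
  linear g -> g (tsum t f) = \tsum_(x ⊗ y <- t) g (f x y).
Proof.
move=> lg; rewrite /tsum /fsum; elim: (repr t) => [|p s IHs].
  by rewrite !big_nil linear_map0.
by rewrite !big_cons linear_mapD // IHs.
Qed.

Lemma tens_mapr_bilinear U V W (g : V -> W) :
  linear g -> bilinear_map (fun (x : U) y => x ⊗ g y).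
Proof.
move=> lg; have [tl tr] := tens_bilinear U W.
by split=> [y|x] c z z'; [exact: tl | rewrite lg; exact: tr].
Qed.

End LinearTsum.

(** * Braided tensor categories *)

Record category := Category {
  obj :> Type;
  hom : obj -> obj -> Type;
  idm : forall X, hom X X;
  compm : forall X Y Z, hom Y Z -> hom X Y -> hom X Z;
  compmA : forall X Y Z T (h : hom Z T) (g : hom Y Z) (f : hom X Y),
    compm h (compm g f) = compm (compm h g) f;
  comp1m : forall X Y (f : hom X Y), compm (idm Y) f = f;
  compm1 : forall X Y (f : hom X Y), compm f (idm X) = f
}.

Arguments hom {C} X Y : rename.
Arguments idm {C} X : rename.
Arguments compm {C X Y Z} g f : rename.

Notation "g \oc f" := (compm g f)
  (at level 50, left associativity, format "g  \oc  f").

Record iso (C : category) (X Y : C) := Iso {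
  iso_fwd :> hom X Y;
  iso_inv : hom Y X;
  iso_fwdK : iso_inv \oc iso_fwd = idm X;
  iso_invK : iso_fwd \oc iso_inv = idm Y
}.

(* The structure is indexed by the tensor product of objects and by the unit
   object, so that these can be prescribed on the nose. *)
Record braided_tensor_structure (C : category) (tob : C -> C -> C) (I : C) :=
    BraidedTensorStructure {
  tmap : forall X X' Y Y' : C,
    hom X X' -> hom Y Y' -> hom (tob X Y) (tob X' Y');
  tmap1 : forall X Y : C, tmap (idm X) (idm Y) = idm (tob X Y);
  tmapM : forall (X X' X'' Y Y' Y'' : C)
      (f' : hom X' X'') (f : hom X X') (g' : hom Y' Y'') (g : hom Y Y'),
    tmap (f' \oc f) (g' \oc g) = tmap f' g' \oc tmap f g;

  assoc : forall X Y Z : C, iso (tob (tob X Y) Z) (tob X (tob Y Z));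
  assoc_natural : forall (X X' Y Y' Z Z' : C)
      (f : hom X X') (g : hom Y Y') (h : hom Z Z'),
    assoc X' Y' Z' \oc tmap (tmap f g) h = tmap f (tmap g h) \oc assoc X Y Z;
  lunit : forall X : C, iso (tob I X) X;
  lunit_natural : forall (X X' : C) (f : hom X X'),
    lunit X' \oc tmap (idm I) f = f \oc lunit X;
  runit : forall X : C, iso (tob X I) X;
  runit_natural : forall (X X' : C) (f : hom X X'),
    runit X' \oc tmap f (idm I) = f \oc runit X;
  pentagon : forall X Y Z T : C,
    assoc X Y (tob Z T) \oc assoc (tob X Y) Z T =
    tmap (idm X) (assoc Y Z T) \oc assoc X (tob Y Z) T
      \oc tmap (assoc X Y Z) (idm T);
  triangle : forall X Y : C,
    tmap (idm X) (lunit Y) \oc assoc X I Y = tmap (runit X) (idm Y);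

  braid : forall X Y : C, iso (tob X Y) (tob Y X);
  braid_natural : forall (X X' Y Y' : C) (f : hom X X') (g : hom Y Y'),
    braid X' Y' \oc tmap f g = tmap g f \oc braid X Y;
  hexagon1 : forall X Y Z : C,
    assoc Y Z X \oc braid X (tob Y Z) \oc assoc X Y Z =
    tmap (idm Y) (braid X Z) \oc assoc Y X Z \oc tmap (braid X Y) (idm Z);
  hexagon2 : forall X Y Z : C,
    iso_inv (assoc Z X Y) \oc braid (tob X Y) Z \oc iso_inv (assoc X Y Z) =
    tmap (braid X Z) (idm Y) \oc iso_inv (assoc X Z Y)
      \oc tmap (idm X) (braid Y Z)
}.

(** * The category of Hom-Yetter-Drinfeld modules *)

Section YDCategory.
Context (K : fieldType) (H : homBialgebra K).
Implicit Types M N P : ydModule H.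

Lemma yd_id_morphism M : is_yd_morphism (@id M).
Proof. by split=> // m; rewrite {1}[yd_coact m]tensorE. Qed.

Lemma yd_comp_morphism M N P (g : ydHom N P) (f : ydHom M N) :
  is_yd_morphism (g \o f).
Proof.
case: g f => [g [lg ga gc gl]] [f [lf fa fc fl]]; split=> /=.
- by move=> c x y; rewrite /= lf lg.
- by move=> h m; rewrite fa ga.
- move=> m; have bt := tens_mapr_bilinear H lg.
  rewrite gc fc (linear_tsum _ _ (tsum_linear bt)).
  by congr (tsum _ _); apply/funext => x; apply/funext => n; rewrite tsum_tens.
- by move=> m; rewrite gl fl.
Qed.

Definition yd_id M : ydHom M M := YDHom (yd_id_morphism M).
Definition yd_comp M N P (g : ydHom N P) (f : ydHom M N) : ydHom M P :=
  YDHom (yd_comp_morphism g f).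

Lemma yd_compA M N P Q (h : ydHom P Q) (g : ydHom N P) (f : ydHom M N) :
  yd_comp h (yd_comp g f) = yd_comp (yd_comp h g) f.
Proof. exact: ydHom_ext. Qed.

Lemma yd_comp1m M N (f : ydHom M N) : yd_comp (yd_id N) f = f.
Proof. exact: ydHom_ext. Qed.

Lemma yd_compm1 M N (f : ydHom M N) : yd_comp f (yd_id M) = f.
Proof. exact: ydHom_ext. Qed.

Definition YD : category := Category yd_compA yd_comp1m yd_compm1.

Definition yd_tensor_data (M N : ydData H) : ydData H :=
  @YDData K H (tensor M N)
    (fun h t => \tsum_(h1 ⊗ h2 <- hDelta h)
                  \tsum_(m ⊗ n <- t) yd_act h1 m ⊗ yd_act h2 n)
    (fun t => \tsum_(m ⊗ n <- t)
                \tsum_(x ⊗ m0 <- yd_coact m)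
                  \tsum_(y ⊗ n0 <- yd_coact n)
                    iter 2 (inv_map (@hbeta K H)) (hmul x y) ⊗ (m0 ⊗ n0))
    (fun t => \tsum_(m ⊗ n <- t) yd_alpha m ⊗ yd_alpha n).

Definition yd_unit_data : ydData H :=
  @YDData K H K^o
    (fun h k => heps h * k)
    (fun k => hone ⊗ k)
    id.

End YDCategory.

(* Main.v *)
(* Every axiom is an identity between Sweedler sums.  Up to powers of [hbeta]
   and [yd_alpha], which can be pushed to the variables because they are
   bijective, it follows from coassociativity and the Yetter-Drinfeld condition
   as for ordinary Yetter-Drinfeld modules.  The left and right unit constraints
   are [k ⊗ m |-> k α^-1(m)] and [m ⊗ k |-> k α^-1(m)].  The antipode is
   anti-multiplicative, so [T := S^-1] satisfies
   [T(h_2) h_1 = h_2 T(h_1) = ε(h) 1]; hence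
   [n ⊗ m |-> α^-1(m_0) ⊗ T(β^2(m_-1)) ▷ α^-1(n)] is inverse to the braiding. *)

Require Import Defs.
From mathcomp Require Import all_boot all_algebra sesquilinear.

Set Implicit Arguments.
Unset Strict Implicit.
Unset Printing Implicit Defensive.

Import GRing.Theory.
Local Open Scope ring_scope.

(** [tsum t f] is computed on a chosen representative of [t]. An axiom stated as an equality of
    tensors can therefore be used inside a sum only if the summand is multilinear in the legs
    concerned. For this reason coassociativity, counitality and the Yetter-Drinfeld condition are
    restated below as laws about sums of an arbitrary multilinear [f], and each use leaves a
    linearity goal. Once the twists are normalized, what has to be chosen is where the deep laws
    act. The Yetter-Drinfeld condition is used for [M] and then for [N] to make [M ⊗ N] an object,
    for [M] to make the braiding linear over [H], and for [N] to make it colinear.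
    Anti-multiplicativity of [S] is uniqueness of convolution inverses: both [S (h k)] and [S k S h]
    invert the multiplication. *)

Section Multilinear.
Context (K : fieldType).
Implicit Types U V W : lmodType K.

Lemma eq_tsum U V W (t : tensor U V) (f g : U -> V -> W) :
  (forall x y, f x y = g x y) -> tsum t f = tsum t g.
Proof. by move=> e; apply: eq_bigr => p _; apply: e. Qed.

(** Both sums run over fixed representatives, so this is an exchange of finite sums and asks nothing
    of [f]; [u] must not depend on [x] and [y]. *)
Lemma tsum_swap U V U' V' W (t : tensor U V) (u : tensor U' V')
    (f : U -> V -> U' -> V' -> W) :
  \tsum_(x ⊗ y <- t) \tsum_(z ⊗ w <- u) f x y z w =
  \tsum_(z ⊗ w <- u) \tsum_(x ⊗ y <- t) f x y z w.
Proof. exact: exchange_big. Qed.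

Lemma tsum_tsum U V U' V' W (t : tensor U V) (f : U -> V -> tensor U' V')
    (g : U' -> V' -> W) :
  bilinear_map g -> tsum (tsum t f) g = \tsum_(x ⊗ y <- t) tsum (f x y) g.
Proof. by move=> bg; apply: linear_tsum (tsum_linear bg). Qed.

Lemma linear_id U : linear (fun x : U => x).
Proof. by []. Qed.

Lemma linear_compose U V W (g : V -> W) (f : U -> V) :
  linear g -> linear f -> linear (fun x => g (f x)).
Proof. by move=> lg lf c x y; rewrite lf lg. Qed.

Lemma scalar_compose U V (g : V -> K) (f : U -> V) :
  scalar g -> linear f -> scalar (fun x => g (f x)).
Proof. by move=> lg lf c x y; rewrite lf lg. Qed.

Lemma linear_tsuml U V U' W (t : W -> tensor U V) (g : U -> V -> U') :
  linear t -> bilinear_map g -> linear (fun x => tsum (t x) g).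
Proof. by move=> lt bg; apply: linear_compose (tsum_linear bg) lt. Qed.

Lemma linear_tsumr U V U' W (t : tensor U V) (g : W -> U -> V -> U') :
  (forall a b, linear (fun x => g x a b)) -> linear (fun x => tsum t (g x)).
Proof.
move=> lg c x y; rewrite /tsum /fsum scaler_sumr -big_split.
by apply: eq_bigr => p _; rewrite lg.
Qed.

Lemma linear_tensl U V (v : V) : linear (fun u : U => u ⊗ v).
Proof. exact: (tens_bilinear U V).1. Qed.

Lemma linear_tensr U V (u : U) : linear (fun v : V => u ⊗ v).
Proof. exact: (tens_bilinear U V).2. Qed.

Lemma linear_scalel U V (f : U -> K) (v : V) :
  scalar f -> linear (fun x => f x *: v).
Proof. by move=> lf c x y; rewrite lf scalerDl scalerA. Qed.

Lemma linear_scaler U V (f : U -> V) (a : K) :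
  linear f -> linear (fun x => a *: f x).
Proof. by move=> lf c x y; rewrite lf scalerDr !scalerA mulrC. Qed.

(** Brings a bare function into the form [fun x => ...] on which the tactic [lin] matches. *)
Lemma linear_eta U V (f : U -> V) : linear (fun x => f x) -> linear f.
Proof. by []. Qed.

Lemma linear_inv_map U (f : U -> U) :
  linear f -> bijective f -> linear (inv_map f).
Proof.
move=> lf fb c x y; apply: (bij_inj fb).
by rewrite lf !inv_mapKV.
Qed.

End Multilinear.

(** * Linearity of the structure maps *)

Section Operations.
Context (K : fieldType) (H : homBialgebra K) (M : ydModule H).

Lemma linear_hmull (y : H) : linear (fun x : H => hmul x y).
Proof. exact: (hmul_bilinear (hbialg_alg H)).1. Qed.
Lemma linear_hmulr (x : H) : linear (hmul x).
Proof. exact: (hmul_bilinear (hbialg_alg H)).2. Qed.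
Lemma linear_hDelta : linear (@hDelta K H).
Proof. exact: Delta_linear (hbialg_coalg H). Qed.
Lemma scalar_heps : scalar (@heps K H).
Proof. exact: eps_linear (hbialg_coalg H). Qed.
Lemma linear_hbeta : linear (@hbeta K H).
Proof. exact: halg_linear (hbialg_alg H). Qed.
Lemma hbeta_bij : bijective (@hbeta K H).
Proof. exact: halg_bij (hbialg_alg H). Qed.
Lemma linear_hbetai : linear (inv_map (@hbeta K H)).
Proof. exact: linear_inv_map linear_hbeta hbeta_bij. Qed.
Lemma linear_actl (m : M) : linear (fun h : H => yd_act h m).
Proof. exact: (act_bilinear (yd_module (ydP M))).1. Qed.
Lemma linear_actr (h : H) : linear (@yd_act K H M h).
Proof. exact: (act_bilinear (yd_module (ydP M))).2. Qed.
Lemma linear_coact : linear (@yd_coact K H M).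
Proof. exact: coact_linear (yd_comodule (ydP M)). Qed.
Lemma linear_alpha : linear (@yd_alpha K H M).
Proof. exact: hmod_linear (yd_module (ydP M)). Qed.
Lemma alpha_bij : bijective (@yd_alpha K H M).
Proof. exact: hmod_bij (yd_module (ydP M)). Qed.
Lemma linear_alphai : linear (inv_map (@yd_alpha K H M)).
Proof. exact: linear_inv_map linear_alpha alpha_bij. Qed.

Lemma linear_ydhom (N : ydModule H) (f : ydHom M N) : linear f.
Proof. exact: ydhom_linear (ydhomP f). Qed.

End Operations.

Definition trilinear (K : fieldType) (U V W X : lmodType K)
    (f : U -> V -> W -> X) :=
  [/\ forall y z, linear (fun x => f x y z),
      forall x z, linear (fun y => f x y z)
    & forall x y, linear (f x y)].

(* Every multilinear map below is an expression in which each bound variable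
   occurs exactly once, so linearity in a variable is decided by following the
   path to its unique occurrence. *)
Ltac lin :=
  cbv beta;
  match goal with
  | |- forall _, _ => intro; lin
  | |- bilinear_for _ _ _ => split; lin
  | |- trilinear _ => split; lin
  | |- GRing.linear_for _ (fun x => x) => exact: linear_id
  | |- GRing.linear_for _ (fun x => tsum ?t (@?g x)) =>
      apply: (linear_tsumr t (g := g)); lin
  | |- GRing.linear_for _ (fun x => tsum (@?t x) ?g) =>
      apply: (linear_tsuml (t := t) (g := g)); lin
  | |- GRing.linear_for _ (fun x => heps (@?f x) *: ?v) =>
      apply/linear_scalel/(scalar_compose (@scalar_heps _ _)); lin
  | |- GRing.linear_for _ (fun x => ?a *: (@?f x)) =>
      apply: linear_scaler; lin
  | |- GRing.linear_for _ (fun x => ?a ⊗ (@?f x)) =>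
      apply: (linear_compose (g := tens a)); [exact: linear_tensr | lin]
  | |- GRing.linear_for _ (fun x => (@?f x) ⊗ ?a) =>
      apply: (linear_compose (g := fun u => u ⊗ a));
        [exact: linear_tensl | lin]
  | |- GRing.linear_for _ (fun x => hmul ?a (@?f x)) =>
      apply: (linear_compose (g := hmul a)); [exact: linear_hmulr | lin]
  | |- GRing.linear_for _ (fun x => hmul (@?f x) ?a) =>
      apply: (linear_compose (g := fun u => hmul u a));
        [exact: linear_hmull | lin]
  | |- GRing.linear_for _ (fun x => @yd_act _ _ ?M ?a (@?f x)) =>
      apply: (linear_compose (g := @yd_act _ _ M a));
        [exact: linear_actr | lin]
  | |- GRing.linear_for _ (fun x => @yd_act _ _ ?M (@?f x) ?a) =>
      apply: (linear_compose (g := fun u => @yd_act _ _ M u a));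
        [exact: linear_actl | lin]
  | |- GRing.linear_for _ (fun x => hDelta (@?f x)) =>
      apply: (linear_compose (@linear_hDelta _ _)); lin
  | |- GRing.linear_for _ (fun x => @yd_coact _ _ ?M (@?f x)) =>
      apply: (linear_compose (g := @yd_coact _ _ M));
        [exact: linear_coact | lin]
  | |- GRing.linear_for _ (fun x => hbeta (@?f x)) =>
      apply: (linear_compose (@linear_hbeta _ _)); lin
  | |- GRing.linear_for _ (fun x => inv_map (@hbeta _ _) (@?f x)) =>
      apply: (linear_compose (@linear_hbetai _ _)); lin
  | |- GRing.linear_for _ (fun x => @yd_alpha _ _ ?M (@?f x)) =>
      apply: (linear_compose (g := @yd_alpha _ _ M));
        [exact: linear_alpha | lin]
  | |- GRing.linear_for _ (fun x => inv_map (@yd_alpha _ _ ?M) (@?f x)) =>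
      apply: (linear_compose (g := inv_map (@yd_alpha _ _ M)));
        [exact: linear_alphai | lin]
  | |- GRing.linear_for _ (fun x => antipode (@?f x)) =>
      apply: (linear_compose (@antipode_linear _ _)); lin
  | lg : GRing.linear_for _ ?g |- GRing.linear_for _ (fun x => ?g (@?f x)) =>
      apply: (linear_compose lg); lin
  | |- GRing.linear_for _ (fun x => ydhom_fun ?g (@?f x)) =>
      apply: (linear_compose (@linear_ydhom _ _ _ _ g)); lin
  | |- GRing.linear_for _ ?f =>
      lazymatch f with (fun x => _) => fail | _ => apply: linear_eta; lin end
  end.

(** * Rewriting Sweedler sums *)

Section Laws.
Context (K : fieldType) (H : homBialgebra K).
Implicit Types (h k l : H) (W : lmodType K) (M : ydModule H).

Local Notation b := (@hbeta K H).
Local Notation bi := (inv_map (@hbeta K H)).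
Local Notation α := (@yd_alpha K H _).
Local Notation αi := (inv_map (@yd_alpha K H _)).

Lemma hbetaK : cancel b bi. Proof. exact: inv_mapK (@hbeta_bij K H). Qed.
Lemma hbetaiK : cancel bi b. Proof. exact: inv_mapKV (@hbeta_bij K H). Qed.

Lemma hbetaM h k : b (hmul h k) = hmul (b h) (b k).
Proof. exact: halgM (hbialg_alg H) _ _. Qed.
Lemma hbetaiM h k : bi (hmul h k) = hmul (bi h) (bi k).
Proof. by rewrite -{1}[h]hbetaiK -{1}[k]hbetaiK -hbetaM hbetaK. Qed.
Lemma hbeta1 : b hone = hone.
Proof. exact: halg1 (hbialg_alg H). Qed.
Lemma hbetai1 : bi hone = hone.
Proof. by rewrite -{1}hbeta1 hbetaK. Qed.
Lemma heps_beta h : heps (b h) = heps h.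
Proof. exact: eps_beta (hbialg_coalg H) _. Qed.
Lemma heps_betai h : heps (bi h) = heps h.
Proof. by rewrite -{2}[h]hbetaiK heps_beta. Qed.
Lemma hmulh1 h : hmul h hone = b h.
Proof. exact: hmul1r (hbialg_alg H) _. Qed.
Lemma hmul1h h : hmul hone h = b h.
Proof. exact: hmul1l (hbialg_alg H) _. Qed.
(** Hom-associativity applies only to a left factor of the form [b h]. Inverting [b] frees that
    factor, which makes the law a rewrite rule; [actA] does the same for actions. *)
Lemma hmul_assoc h k l : hmul h (hmul k l) = hmul (hmul (bi h) k) (b l).
Proof. by rewrite -{1}[h]hbetaiK (hmulA (hbialg_alg H)). Qed.

Lemma alphaK M : cancel (@yd_alpha K H M) αi.
Proof. exact: inv_mapK (@alpha_bij K H M). Qed.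
Lemma alphaiK M : cancel (inv_map (@yd_alpha K H M)) α.
Proof. exact: inv_mapKV (@alpha_bij K H M). Qed.
Lemma alphaA M h (m : M) : α (yd_act h m) = yd_act (b h) (α m).
Proof. exact: alpha_act (yd_module (ydP M)) _ _. Qed.
Lemma alphaiA M h (m : M) : αi (yd_act h m) = yd_act (bi h) (αi m).
Proof. by rewrite -{1}[h]hbetaiK -{1}[m]alphaiK -alphaA alphaK. Qed.
Lemma actA M h k (m : M) : yd_act h (yd_act k m) = yd_act (hmul (bi h) k) (α m).
Proof. by rewrite -{1}[h]hbetaiK (act_assoc (yd_module (ydP M))). Qed.
Lemma act1m M (m : M) : yd_act hone m = α m.
Proof. exact: act1 (yd_module (ydP M)) _. Qed.

Lemma heps_hmulZ h k W (v : W) :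
  heps (hmul h k) *: v = heps h *: (heps k *: v).
Proof. by rewrite hepsM scalerA. Qed.

(* Normal form: [hbeta] and [yd_alpha] are pushed to the variables, products
   associate to the left, and nested actions are merged. *)
Definition hom_simp :=
  (hbetaK, hbetaiK, hbetaM, hbetaiM, hbeta1, hbetai1, heps_beta, heps_betai,
   hmulh1, hmul1h, hmul_assoc, alphaK, alphaiK, alphaA, alphaiA, actA, act1m,
   heps_hmulZ, heps1, scale1r).

Lemma tsum_Delta_beta W (f : H -> H -> W) h : bilinear_map f ->
  tsum (hDelta (b h)) f = \tsum_(h1 ⊗ h2 <- hDelta h) f (b h1) (b h2).
Proof.
move=> bf; rewrite (Delta_beta (hbialg_coalg H)) tsum_tsum //.
by apply: eq_tsum => x y; rewrite tsum_tens.
Qed.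

Lemma tsum_Delta_betai W (f : H -> H -> W) h : bilinear_map f ->
  tsum (hDelta (bi h)) f = \tsum_(h1 ⊗ h2 <- hDelta h) f (bi h1) (bi h2).
Proof.
move=> [fl fr]; rewrite -[h in RHS]hbetaiK tsum_Delta_beta.
  by apply: eq_tsum => x y; rewrite !hbetaK.
split=> x.
  exact: linear_compose (fl (bi x)) (@linear_hbetai K H).
exact: linear_compose (fr (bi x)) (@linear_hbetai K H).
Qed.

Lemma tsum_DeltaM W (f : H -> H -> W) h k : bilinear_map f ->
  tsum (hDelta (hmul h k)) f =
  \tsum_(h1 ⊗ h2 <- hDelta h) \tsum_(k1 ⊗ k2 <- hDelta k)
    f (hmul h1 k1) (hmul h2 k2).
Proof.
move=> bf; rewrite hDeltaM tsum_tsum //; apply: eq_tsum => h1 h2.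
by rewrite tsum_tsum //; apply: eq_tsum => k1 k2; rewrite tsum_tens.
Qed.

Lemma tsum_Delta1 W (f : H -> H -> W) : bilinear_map f ->
  tsum (hDelta hone) f = f hone hone.
Proof. by move=> bf; rewrite hDelta1 tsum_tens. Qed.

Lemma tsum_coact_alpha M W (f : H -> M -> W) m : bilinear_map f ->
  tsum (yd_coact (α m)) f = \tsum_(x ⊗ m0 <- yd_coact m) f (b x) (α m0).
Proof.
move=> bf; rewrite (coact_alpha (yd_comodule (ydP M))) tsum_tsum //.
by apply: eq_tsum => x y; rewrite tsum_tens.
Qed.

Lemma tsum_coact_alphai M W (f : H -> M -> W) m : bilinear_map f ->
  tsum (yd_coact (αi m)) f = \tsum_(x ⊗ m0 <- yd_coact m) f (bi x) (αi m0).
Proof.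
move=> [fl fr]; rewrite -[m in RHS]alphaiK tsum_coact_alpha.
  by apply: eq_tsum => x y; rewrite hbetaK alphaK.
split=> x.
  exact: linear_compose (fl (αi x)) (@linear_hbetai K H).
exact: linear_compose (fr (bi x)) (@linear_alphai K H M).
Qed.

Lemma tsum_Delta_epsl W (f : H -> W) h : linear f ->
  \tsum_(h1 ⊗ h2 <- hDelta h) heps h1 *: f h2 = f (b h).
Proof.
move=> lf; rewrite -(eps_counitl (hbialg_coalg H)) linear_tsum //.
by apply: eq_tsum => x y; rewrite linear_mapZ.
Qed.

Lemma tsum_Delta_epsr W (f : H -> W) h : linear f ->
  \tsum_(h1 ⊗ h2 <- hDelta h) heps h2 *: f h1 = f (b h).
Proof.
move=> lf; rewrite -(eps_counitr (hbialg_coalg H)) linear_tsum //.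
by apply: eq_tsum => x y; rewrite linear_mapZ.
Qed.

Lemma tsum_coact_eps M W (f : M -> W) m : linear f ->
  \tsum_(x ⊗ m0 <- yd_coact m) heps x *: f m0 = f (α m).
Proof.
move=> lf; rewrite -(coact_counit (yd_comodule (ydP M))) linear_tsum //.
by apply: eq_tsum => x y; rewrite linear_mapZ.
Qed.

End Laws.

(** * Coassociativity and the Yetter-Drinfeld condition under multilinear maps *)

Section Trilinear.
Context (K : fieldType).
Implicit Types U V W X : lmodType K.

(** A trilinear map is evaluated on a right-bracketed threefold tensor by nesting [tsum];
    bilinearity of the outer map makes this independent of representatives. *)
Lemma linear_tens3 U V W X (f : U -> V -> W -> X) :
  trilinear f -> bilinear_map (fun x s => tsum s (f x)).
Proof.
move=> [f1 f2 f3]; split=> [s|x]; last by apply: tsum_linear; split.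
by apply: linear_tsumr => y z; apply: f1.
Qed.

(** The inner tensor [r] may depend on either leg of the outer one, so this one shape covers both
    sides of coassociativity, for [hDelta] and for coactions. *)
Lemma tsum_tens3 A B C D U V W X (f : U -> V -> W -> X) (t : tensor A B)
    (r : A -> B -> tensor C D) (u : A -> B -> C -> D -> U)
    (v : A -> B -> C -> D -> V) (w : A -> B -> C -> D -> W) :
  trilinear f ->
  tsum (\tsum_(x ⊗ y <- t) \tsum_(z ⊗ s <- r x y)
          u x y z s ⊗ (v x y z s ⊗ w x y z s)) (fun x s => tsum s (f x)) =
  \tsum_(x ⊗ y <- t) \tsum_(z ⊗ s <- r x y)
    f (u x y z s) (v x y z s) (w x y z s).
Proof.
move=> tf; have bf := linear_tens3 tf; have [f1 f2 f3] := tf.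
rewrite tsum_tsum //; apply: eq_tsum => x y.
rewrite tsum_tsum //; apply: eq_tsum => z s.
by rewrite tsum_tens // tsum_tens //; split.
Qed.

End Trilinear.

Section Coassociativity.
Context (K : fieldType) (H : homBialgebra K).
Implicit Types (h k l : H) (W : lmodType K) (M : ydModule H).

Local Notation b := (@hbeta K H).
Local Notation bi := (inv_map (@hbeta K H)).
Local Notation α := (@yd_alpha K H _).

Lemma trilinear_betai (V V' W : lmodType K) (f : H -> V -> V' -> W) :
  trilinear f -> trilinear (fun x => f (bi x)).
Proof.
move=> [f1 f2 f3]; split=> // y z.
exact: linear_compose (f1 y z) (@linear_hbetai K H).
Qed.

(** The axiom has [b] on the first leg of its left side. Evaluating it against [f] precomposed with
    [bi] in the first argument cancels that [b], so the left side matches any trilinear summand. *)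
Lemma tsum_coassoc W (f : H -> H -> H -> W) h : trilinear f ->
  \tsum_(h1 ⊗ h2 <- hDelta h) \tsum_(h21 ⊗ h22 <- hDelta h2) f h1 h21 h22 =
  \tsum_(h1 ⊗ h2 <- hDelta h) \tsum_(h11 ⊗ h12 <- hDelta h1)
    f (bi h11) h12 (b h2).
Proof.
move=> /trilinear_betai tf.
transitivity (\tsum_(h1 ⊗ h2 <- hDelta h)
    \tsum_(h21 ⊗ h22 <- hDelta h2) f (bi (b h1)) h21 h22).
  by do 2 apply: eq_tsum => ? ?; rewrite hbetaK.
rewrite -(tsum_tens3 _ _ _ _ _ tf) (Delta_coassoc (hbialg_coalg H)).
exact: (tsum_tens3 _ _ _ _ _ tf).
Qed.

Lemma tsum_coact_coassoc M W (f : H -> H -> M -> W) m : trilinear f ->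
  \tsum_(x ⊗ m0 <- yd_coact m) \tsum_(y ⊗ m00 <- yd_coact m0) f x y m00 =
  \tsum_(x ⊗ m0 <- yd_coact m) \tsum_(x1 ⊗ x2 <- hDelta x)
    f (bi x1) x2 (α m0).
Proof.
move=> /trilinear_betai tf.
transitivity (\tsum_(x ⊗ m0 <- yd_coact m)
    \tsum_(y ⊗ m00 <- yd_coact m0) f (bi (b x)) y m00).
  by do 2 apply: eq_tsum => ? ?; rewrite hbetaK.
rewrite -(tsum_tens3 _ _ _ _ _ tf) (coact_coassoc (yd_comodule (ydP M))).
exact: (tsum_tens3 _ _ _ _ _ tf).
Qed.

Lemma tsum_yd M W (f : H -> M -> W) h m : bilinear_map f ->
  \tsum_(h1 ⊗ h2 <- hDelta h) \tsum_(x ⊗ m0 <- yd_coact m)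
    f (hmul h1 (b x)) (yd_act (b (b (b h2))) m0) =
  \tsum_(h1 ⊗ h2 <- hDelta h)
    \tsum_(x ⊗ n0 <- yd_coact (yd_act (b (b h1)) m)) f (hmul x h2) n0.
Proof.
move=> bf; have /(congr1 (fun t => tsum t f)) := yd_compat (ydP M) h m.
rewrite !tsum_tsum //= => e.
etransitivity; [symmetry | etransitivity; first exact: e];
  apply: eq_tsum => h1 h2; rewrite tsum_tsum //;
  by apply: eq_tsum => x y; rewrite tsum_tens.
Qed.

End Coassociativity.

(* On a goal [E = ?R], [hom_norm] instantiates [?R] with a normal form of [E]:
   nested sums are flattened into sums over [hDelta] and [yd_coact] of
   expressions that cannot be expanded further, and the summand is normalized
   by [hom_simp].  Neither the order of the sums nor the two sides of
   coassociativity are normalized. *)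
Ltac hom_norm :=
  cbv beta;
  lazymatch goal with
  | |- tsum (hDelta _) ?f = _ =>
    etransitivity;
      [apply: (f_equal (fun x => tsum (hDelta x) f));
         rewrite ?hom_simp; reflexivity
      | hom_norm_sum]
  | |- tsum (yd_coact _) ?f = _ =>
    etransitivity;
      [apply: (f_equal (fun x => tsum (yd_coact x) f));
         rewrite ?hom_simp; reflexivity
      | hom_norm_sum]
  | |- tsum _ _ = _ => hom_norm_sum
  | |- _ ⊗ _ = _ =>
    etransitivity;
      [apply: (f_equal2 tens); hom_norm
      | lazymatch goal with
        | |- ?a ⊗ tsum _ _ = _ =>
          etransitivity;
            [apply: (linear_tsum _ _ (@linear_tensr _ _ _ a)) | hom_norm]
        | |- tsum _ _ ⊗ ?a = _ =>
          etransitivity;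
            [apply: (linear_tsum _ _ (@linear_tensl _ _ _ a)) | hom_norm]
        | |- _ => reflexivity
        end]
  | |- _ => rewrite ?hom_simp; reflexivity
  end
with hom_norm_sum :=
  lazymatch goal with
  | |- tsum ?t _ = _ =>
    lazymatch t with
    | tsum _ _ => etransitivity; [apply: tsum_tsum; lin | hom_norm]
    | _ ⊗ _ => etransitivity; [apply: tsum_tens; lin | hom_norm]
    | hDelta (hbeta _) =>
        etransitivity; [apply: tsum_Delta_beta; lin | hom_norm]
    | hDelta (inv_map _ _) =>
        etransitivity; [apply: tsum_Delta_betai; lin | hom_norm]
    | hDelta (hmul _ _) =>
        etransitivity; [apply: tsum_DeltaM; lin | hom_norm]
    | hDelta hone => etransitivity; [apply: tsum_Delta1; lin | hom_norm]
    | yd_coact (yd_alpha _) =>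
        etransitivity; [apply: tsum_coact_alpha; lin | hom_norm]
    | yd_coact (inv_map _ _) =>
        etransitivity; [apply: tsum_coact_alphai; lin | hom_norm]
    | _ => apply: eq_tsum => ? ?; hom_norm
    end
  end.

(* Rewriting below the [n] outermost sums is congruence over fixed representatives, so descending
   creates no linearity goals. *)
Tactic Notation "in_sums" integer(n) tactic3(tac) :=
  etransitivity; [do n (apply: eq_tsum => ? ?); tac; reflexivity | cbv beta].

Ltac hom_lhs := etransitivity; [hom_norm | cbv beta].
Ltac hom_rhs := symmetry; hom_lhs; symmetry.
Ltac hom_simpl := hom_lhs; hom_rhs.

(** * Tensor products and the unit object *)

Section TensorObject.
Context (K : fieldType) (H : homBialgebra K).
Implicit Types (M N P : ydModule H) (h k l : H).
Local Notation b := (@hbeta K H).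
Local Notation bi := (inv_map (@hbeta K H)).
Local Notation α := (@yd_alpha K H _).
Local Notation αi := (inv_map (@yd_alpha K H _)).

Lemma tensor_linear_alpha M N : linear (@yd_alpha K H (yd_tensor_data M N)).
Proof. by rewrite /=; lin. Qed.

Lemma tensor_alpha_bij M N :
  bijective (@yd_alpha K H (yd_tensor_data M N)).
Proof.
exists (fun t => \tsum_(m ⊗ n <- t) αi m ⊗ αi n) => /=;
  by apply: tensor_ext; [lin | lin | move=> m n; hom_lhs].
Qed.

Lemma tensor_is_module M N :
  is_hom_module (@yd_act K H (yd_tensor_data M N)) yd_alpha.
Proof.
split; [ | exact: tensor_linear_alpha | exact: tensor_alpha_bij | | | ] => /=.
- by lin.
- move=> h; apply: tensor_ext; [lin | lin | move=> m n].
  by hom_simpl.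
- move=> h k; apply: tensor_ext; [lin | lin | move=> m n].
  by hom_simpl.
- by apply: tensor_ext; [lin | lin | move=> m n; hom_simpl].
Qed.

Lemma tensor_is_comodule M N :
  is_hom_comodule (@yd_coact K H (yd_tensor_data M N)) yd_alpha.
Proof.
split; [ | exact: tensor_linear_alpha | exact: tensor_alpha_bij | | | ] => /=.
- by lin.
- apply: tensor_ext; [lin | lin | move=> m n].
  by hom_simpl.
- apply: tensor_ext; [lin | lin | move=> m n].
  hom_simpl.
  (* Coassociativity needs adjacent sums: the second coaction of [m] is moved next to the first,
     which also brings the two coactions of [n] together. *)
  in_sums 1 rewrite tsum_swap.
  rewrite tsum_coact_coassoc; last by lin.
  in_sums 2 (rewrite tsum_coact_coassoc; last by lin).
  hom_lhs.
  in_sums 1 (rewrite tsum_swap).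
  by [].
- apply: tensor_ext; [lin | lin | move=> m n].
  hom_simpl.
  rewrite tsum_swap.
  in_sums 1 (rewrite tsum_coact_eps; last by lin).
  by rewrite tsum_coact_eps; last by lin.
Qed.

(** The condition for [M] is applied to the first two legs of a threefold coproduct of [h], then the
    condition for [N] to the last two. Coassociativity regroups the legs before, between and
    after. *)
Lemma tensor_is_yd M N : is_yd (yd_tensor_data M N).
Proof.
split; [exact: tensor_is_module | exact: tensor_is_comodule | ].
move=> h; apply: tensor_ext; [by rewrite /=; lin | by rewrite /=; lin |].
move=> m n /=; hom_simpl.
in_sums 1 (in_sums 1 (rewrite tsum_swap); exact: tsum_swap).
rewrite tsum_coassoc; last by lin.
(* [f] is the rest of the expression seen as a function of the two slots of the condition for [M];
   its powers of [b] are those left by normalization. [g] below does the same for [N]. *)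
pose f h2 u (v : M) := \tsum_(y ⊗ n0 <- yd_coact n)
  hmul (bi (bi u)) y ⊗ (v ⊗ yd_act (b (b (b (b h2)))) n0).
transitivity (\tsum_(h1 ⊗ h2 <- hDelta h) \tsum_(h11 ⊗ h12 <- hDelta h1)
    \tsum_(x ⊗ m0 <- yd_coact m)
      f h2 (hmul h11 (b x)) (yd_act (b (b (b h12))) m0)).
  by rewrite /f; hom_simpl.
in_sums 1 (rewrite tsum_yd; last by rewrite /f; lin).
pose g x (m0 : M) u (v : N) := hmul (bi x) (bi (bi u)) ⊗ (m0 ⊗ v).
transitivity (\tsum_(h1 ⊗ h2 <- hDelta h)
    \tsum_(x ⊗ m0 <- yd_coact (yd_act (b (b (b h1))) m))
    \tsum_(h21 ⊗ h22 <- hDelta h2) \tsum_(y ⊗ n0 <- yd_coact n)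
      g x m0 (hmul h21 (b y)) (yd_act (b (b (b h22))) n0)).
  symmetry; in_sums 1 (rewrite tsum_swap).
  rewrite tsum_coassoc; last by rewrite /g; lin.
  by rewrite /f /g; hom_simpl.
in_sums 2 (rewrite tsum_yd; last by rewrite /g; lin).
in_sums 1 (rewrite tsum_swap).
rewrite tsum_coassoc; last by rewrite /g; lin.
by rewrite /g; hom_simpl.
Qed.

Definition yd_tensor M N : ydModule H := YDModule (tensor_is_yd M N).

Lemma tensor_actE M N h (m : M) (n : N) :
  @yd_act K H (yd_tensor M N) h (m ⊗ n) =
  \tsum_(h1 ⊗ h2 <- hDelta h) yd_act h1 m ⊗ yd_act h2 n.
Proof. by apply: eq_tsum => h1 h2; rewrite tsum_tens; last by lin. Qed.

Lemma tensor_coactE M N (m : M) (n : N) :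
  @yd_coact K H (yd_tensor M N) (m ⊗ n) =
  \tsum_(x ⊗ m0 <- yd_coact m) \tsum_(y ⊗ n0 <- yd_coact n)
    bi (bi (hmul x y)) ⊗ (m0 ⊗ n0).
Proof. by rewrite /= tsum_tens; last by lin. Qed.

Lemma tensor_alphaE M N (m : M) (n : N) :
  @yd_alpha K H (yd_tensor M N) (m ⊗ n) = α m ⊗ α n.
Proof. by rewrite /= tsum_tens; last by lin. Qed.

(** [inv_map] is a pseudo-inverse that does not compute, so its value is identified by applying the
    injective [α] of the tensor product. *)
Lemma tensor_alphaiE M N (m : M) (n : N) :
  inv_map (@yd_alpha K H (yd_tensor M N)) (m ⊗ n) = αi m ⊗ αi n.
Proof.
apply: (bij_inj (@alpha_bij K H (yd_tensor M N))).
by rewrite alphaiK tensor_alphaE !alphaiK.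
Qed.

Lemma unit_is_yd : is_yd (yd_unit_data H).
Proof.
have eps_bil : bilinear_map (fun (h : H) (k : K^o) => heps h * k : K^o).
  split=> [k|h] c x y /=.
    by rewrite scalar_heps mulrDl scalerAl.
  by rewrite mulrDr scalerAr.
split=> /=.
- split=> //=; first by exists id.
  + by move=> h k; rewrite heps_beta.
  + by move=> h k m; rewrite heps_beta hepsM mulrA.
  + by move=> m; rewrite heps1 mul1r.
- split=> //=.
  + exact: linear_tensr.
  + by exists id.
  + by move=> k; hom_simpl.
  + by move=> k; hom_simpl.
  + by move=> k; rewrite tsum_tens ?heps1 ?scale1r //; lin.
- move=> h k /=.
  have bl (u : H -> H) (c : K) : linear u ->
      bilinear_map (fun x (m : K^o) => u x ⊗ (c *: m)).
    by move=> lu; lin.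
  (* Multiplication by [hone] contributes one [b] and the counit law another, on both sides. *)
  transitivity (b (b h) ⊗ (k : K^o)); [|symmetry].
    rewrite -(tsum_Delta_epsr (f := fun x => b x ⊗ (k : K^o))); last by lin.
    apply: eq_tsum => h1 h2; rewrite (tsum_tens _ _ (bl _ _ _)) /=; last by lin.
    rewrite ?hom_simp; exact: (linear_mapZ _ _ (linear_tensr _)).
  rewrite -(tsum_Delta_epsl (f := fun x => b x ⊗ (k : K^o))); last by lin.
  apply: eq_tsum => h1 h2; rewrite tsum_tens ?hom_simp; last by lin.
  exact: (linear_mapZ _ _ (linear_tensr _)).
Qed.

Definition yd_unit : ydModule H := YDModule unit_is_yd.

End TensorObject.

(** * Structure morphisms *)

Section Morphisms.
Context (K : fieldType) (H : homBialgebra K).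
Implicit Types (M N P : ydModule H) (h k l : H).
Local Notation b := (@hbeta K H).
Local Notation bi := (inv_map (@hbeta K H)).
Local Notation α := (@yd_alpha K H _).
Local Notation αi := (inv_map (@yd_alpha K H _)).

Lemma tsum_coact_ydhom M N (f : ydHom M N) (W : lmodType K)
    (g : H -> N -> W) m : bilinear_map g ->
  tsum (yd_coact (f m)) g = \tsum_(x ⊗ m0 <- yd_coact m) g x (f m0).
Proof.
move=> bg; rewrite (ydhom_coact (ydhomP f)) tsum_tsum //.
by apply: eq_tsum => x m0; rewrite tsum_tens.
Qed.

Lemma ydHom_alphai M N (f : ydHom M N) m : f (αi m) = αi (f m).
Proof. by rewrite -{2}[m]alphaiK -(ydhom_alpha (ydhomP f)) alphaK. Qed.

Lemma coact_alphaiE M m :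
  yd_coact (αi m : M) = \tsum_(x ⊗ m0 <- yd_coact m) bi x ⊗ αi m0.
Proof.
rewrite -(tsum_coact_alphai _ (tens_bilinear _ _)).
exact: tensorE.
Qed.

(** Since [f] is injective, identities for [g] can be checked after applying [f]. Hence each
    structural isomorphism has to be shown a morphism in one direction only. *)
Lemma inverse_is_morphism M N (f : ydHom M N) (g : N -> M) :
  cancel f g -> cancel g f -> is_yd_morphism g.
Proof.
move=> fK gK; have [lf fa fc fl] := ydhomP f; have fi := can_inj fK.
have lg : linear g by move=> c x y; apply: fi; rewrite lf !gK.
split=> //.
- by move=> h n; apply: fi; rewrite fa !gK.
- move=> n; rewrite -{2}[n]gK tsum_coact_ydhom; last by lin.
  under [RHS]eq_tsum => x m0 do rewrite fK.
  exact: tensorE.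
- by move=> n; apply: fi; rewrite -fl !gK.
Qed.

Definition yd_iso M N (f : ydHom M N) (g : N -> M) (fK : cancel f g)
    (gK : cancel g f) : @iso (YD H) M N :=
  @Iso (YD H) M N f (YDHom (inverse_is_morphism fK gK))
    (ydHom_ext (fK : yd_comp (YDHom (inverse_is_morphism fK gK)) f =1 yd_id M))
    (ydHom_ext (gK : yd_comp f (YDHom (inverse_is_morphism fK gK)) =1 yd_id N)).

Lemma tmap_is_morphism M M' N N' (f : ydHom M M') (g : ydHom N N') :
  @is_yd_morphism K H (yd_tensor M N) (yd_tensor M' N')
    (fun t => \tsum_(m ⊗ n <- t) f m ⊗ g n).
Proof.
split=> /=.
- by lin.
- move=> h; apply: tensor_ext; [lin | lin | move=> m n].
  hom_simpl.
  by apply: eq_tsum => ? ?; rewrite !(ydhom_act (ydhomP _)).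
- apply: tensor_ext; [lin | lin | move=> m n].
  hom_simpl.
  rewrite tsum_coact_ydhom; last by lin.
  by in_sums 1 (rewrite tsum_coact_ydhom; last by lin).
- apply: tensor_ext; [lin | lin | move=> m n].
  by hom_simpl; rewrite !(ydhom_alpha (ydhomP _)).
Qed.

Definition yd_tmap (M M' N N' : YD H) (f : Defs.hom M M')
    (g : Defs.hom N N') :
    Defs.hom (yd_tensor M N : YD H) (yd_tensor M' N' : YD H) :=
  YDHom (tmap_is_morphism f g).

Lemma yd_tmapE M M' N N' (f : ydHom M M') (g : ydHom N N') m n :
  (yd_tmap f g : ydHom _ _) (m ⊗ n) = f m ⊗ g n.
Proof. by rewrite /= tsum_tens; last by lin. Qed.

Definition assoc_fun M N P (t : tensor (tensor M N) P) :
    tensor M (tensor N P) :=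
  \tsum_(s ⊗ p <- t) \tsum_(m ⊗ n <- s) αi m ⊗ (n ⊗ α p).

Definition associ_fun M N P (t : tensor M (tensor N P)) :
    tensor (tensor M N) P :=
  \tsum_(m ⊗ s <- t) \tsum_(n ⊗ p <- s) (α m ⊗ n) ⊗ αi p.

Lemma assoc_funE M N P (m : M) (n : N) (p : P) :
  assoc_fun (m ⊗ n ⊗ p) = αi m ⊗ (n ⊗ α p).
Proof. by rewrite /assoc_fun; hom_lhs. Qed.

Lemma assoc_funK M N P : cancel (@assoc_fun M N P) (@associ_fun M N P).
Proof.
rewrite /assoc_fun /associ_fun.
apply: tensor_ext; [lin | lin | move=> s p].
by move: s; apply: tensor_ext; [lin | lin | move=> m n; hom_simpl].
Qed.

Lemma associ_funK M N P : cancel (@associ_fun M N P) (@assoc_fun M N P).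
Proof.
rewrite /assoc_fun /associ_fun.
apply: tensor_ext; [lin | lin | move=> m].
by apply: tensor_ext; [lin | lin | move=> n p; hom_simpl].
Qed.

(** Linearity over [H] is coassociativity: [αi] on [M] and [α] on [P] produce exactly the [bi] and
    [b] of [tsum_coassoc]. Colinearity is Hom-associativity of the product, which normalization
    settles. *)
Lemma assoc_is_morphism M N P :
  @is_yd_morphism K H (yd_tensor (yd_tensor M N) P)
    (yd_tensor M (yd_tensor N P)) (@assoc_fun M N P).
Proof.
rewrite /assoc_fun; split=> /=.
- by lin.
- move=> h; apply: tensor_ext; [lin | lin | move=> s p].
  move: s; apply: tensor_ext; [lin | lin | move=> m n].
  hom_simpl.
  symmetry; rewrite tsum_coassoc; last by lin.
  by hom_simpl.
- apply: tensor_ext; [lin | lin | move=> s p].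
  move: s; apply: tensor_ext; [lin | lin | move=> m n].
  by hom_simpl.
- apply: tensor_ext; [lin | lin | move=> s p].
  move: s; apply: tensor_ext; [lin | lin | move=> m n].
  by hom_simpl.
Qed.

Definition yd_assoc M N P :=
  @yd_iso (yd_tensor (yd_tensor M N) P) (yd_tensor M (yd_tensor N P))
    (YDHom (assoc_is_morphism M N P)) _ (@assoc_funK M N P)
    (@associ_funK M N P).

(** By counitality [h] sends [1 ⊗ m] to [1 ⊗ (b h ▷ m)], and [αi] removes this extra [b]. In the
    triangle it cancels the [α] that the associator puts on the last factor. *)
Definition lunit_fun M (t : tensor K^o M) : M := \tsum_(k ⊗ m <- t) k *: αi m.
Definition runit_fun M (t : tensor M K^o) : M := \tsum_(m ⊗ k <- t) k *: αi m.

Lemma lunit_bilinear M : bilinear_map (fun (k : K^o) (m : M) => k *: αi m).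
Proof.
split=> [m|k]; last by lin.
by move=> c x y; rewrite scalerDl; congr (_ + _); symmetry; apply: scalerA.
Qed.

Lemma runit_bilinear M : bilinear_map (fun (m : M) (k : K^o) => k *: αi m).
Proof. by have [l1 l2] := lunit_bilinear M; split. Qed.

Lemma lunit_funE M (k : K^o) (m : M) : lunit_fun (k ⊗ m) = k *: αi m.
Proof. exact: tsum_tens _ _ (lunit_bilinear M). Qed.

Lemma runit_funE M (m : M) (k : K^o) : runit_fun (m ⊗ k) = k *: αi m.
Proof. exact: tsum_tens _ _ (runit_bilinear M). Qed.

Lemma linear_lunit_fun M : linear (@lunit_fun M).
Proof. exact: tsum_linear (lunit_bilinear M). Qed.

Lemma linear_runit_fun M : linear (@runit_fun M).
Proof. exact: tsum_linear (runit_bilinear M). Qed.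

Lemma lunit_funK M : cancel (@lunit_fun M) (fun m => (1 : K^o) ⊗ α m).
Proof.
have ll := @linear_lunit_fun M.
apply: tensor_ext; [lin | lin | move=> k m].
rewrite lunit_funE linear_mapZ ?alphaiK; last exact: linear_alpha.
rewrite (linear_mapZ _ _ (linear_tensr _)) -(linear_mapZ _ _ (linear_tensl _)).
by congr (_ ⊗ _); apply: mulr1.
Qed.

Lemma runit_funK M : cancel (@runit_fun M) (fun m => α m ⊗ (1 : K^o)).
Proof.
have ll := @linear_runit_fun M.
apply: tensor_ext; [lin | lin | move=> m k].
rewrite runit_funE linear_mapZ ?alphaiK; last exact: linear_alpha.
rewrite (linear_mapZ _ _ (linear_tensl _)) -(linear_mapZ _ _ (linear_tensr _)).
by congr (_ ⊗ _); apply: mulr1.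
Qed.

Lemma lunit_invK M : cancel (fun m => (1 : K^o) ⊗ α m) (@lunit_fun M).
Proof. by move=> m; rewrite lunit_funE scale1r alphaK. Qed.

Lemma runit_invK M : cancel (fun m => α m ⊗ (1 : K^o)) (@runit_fun M).
Proof. by move=> m; rewrite runit_funE scale1r alphaK. Qed.

Lemma lunit_is_morphism M :
  @is_yd_morphism K H (yd_tensor (yd_unit H) M) M (@lunit_fun M).
Proof.
have ll := @linear_lunit_fun M; split=> //.
- move=> h; apply: tensor_ext; [lin | lin | move=> k m].
  rewrite tensor_actE linear_tsum // lunit_funE.
  transitivity (\tsum_(h1 ⊗ h2 <- hDelta h)
      heps h1 *: (k *: yd_act (bi h2) (αi m))).
    by apply: eq_tsum => h1 h2; rewrite lunit_funE alphaiA scalerA.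
  rewrite tsum_Delta_epsl ?hbetaK; last by lin.
  by rewrite (linear_mapZ _ _ (linear_actr _)).
- apply: tensor_ext; [lin | lin | move=> k m].
  rewrite tensor_coactE lunit_funE (linear_mapZ _ _ (@linear_coact _ _ _)).
  rewrite coact_alphaiE linear_tsum; last by apply: linear_scaler; lin.
  rewrite [yd_coact k]/=; hom_rhs.
  apply: eq_tsum => x m0.
  by rewrite lunit_funE (linear_mapZ _ _ (linear_tensr _)).
- apply: tensor_ext; [lin | lin | move=> k m].
  rewrite tensor_alphaE !lunit_funE (linear_mapZ _ _ (@linear_alpha _ _ _)).
  by rewrite !hom_simp.
Qed.

Lemma runit_is_morphism M :
  @is_yd_morphism K H (yd_tensor M (yd_unit H)) M (@runit_fun M).
Proof.
have ll := @linear_runit_fun M; split=> //.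
- move=> h; apply: tensor_ext; [lin | lin | move=> m k].
  rewrite tensor_actE linear_tsum // runit_funE.
  transitivity (\tsum_(h1 ⊗ h2 <- hDelta h)
      heps h2 *: (k *: yd_act (bi h1) (αi m))).
    by apply: eq_tsum => h1 h2; rewrite runit_funE alphaiA scalerA.
  rewrite tsum_Delta_epsr ?hbetaK; last by lin.
  by rewrite (linear_mapZ _ _ (linear_actr _)).
- apply: tensor_ext; [lin | lin | move=> m k].
  rewrite tensor_coactE runit_funE (linear_mapZ _ _ (@linear_coact _ _ _)).
  rewrite coact_alphaiE linear_tsum; last by apply: linear_scaler; lin.
  rewrite [yd_coact k]/=; hom_rhs.
  apply: eq_tsum => x m0.
  by rewrite runit_funE (linear_mapZ _ _ (linear_tensr _)).
- apply: tensor_ext; [lin | lin | move=> m k].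
  rewrite tensor_alphaE !runit_funE (linear_mapZ _ _ (@linear_alpha _ _ _)).
  by rewrite !hom_simp.
Qed.

Definition yd_lunit M := @yd_iso (yd_tensor (yd_unit H) M) M
  (YDHom (lunit_is_morphism M)) _ (@lunit_funK M) (@lunit_invK M).
Definition yd_runit M := @yd_iso (yd_tensor M (yd_unit H)) M
  (YDHom (runit_is_morphism M)) _ (@runit_funK M) (@runit_invK M).

Definition braid_fun M N (t : tensor M N) : tensor N M :=
  \tsum_(m ⊗ n <- t) \tsum_(x ⊗ m0 <- yd_coact m)
    yd_act (b (b x)) (αi n) ⊗ αi m0.

Lemma braid_funE M N (m : M) (n : N) :
  braid_fun (m ⊗ n) =
  \tsum_(x ⊗ m0 <- yd_coact m) yd_act (b (b x)) (αi n) ⊗ αi m0.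
Proof. by rewrite /braid_fun tsum_tens; last by lin. Qed.

Lemma braid_is_morphism M N :
  @is_yd_morphism K H (yd_tensor M N) (yd_tensor N M) (@braid_fun M N).
Proof.
rewrite /braid_fun; split=> /=.
- by lin.
- move=> h; apply: tensor_ext; [lin | lin | move=> m n].
  pose f u (v : M) := yd_act (b u) n ⊗ αi v.
  (* The Yetter-Drinfeld condition acts on [m] through [b (b h1)], whereas here [h1] itself acts;
     hence the condition is taken at [bi (bi h)]. *)
  transitivity (\tsum_(h1 ⊗ h2 <- hDelta (bi (bi h)))
    \tsum_(x ⊗ n0 <- yd_coact (yd_act (b (b h1)) m)) f (hmul x h2) n0).
    by rewrite /f; hom_simpl.
  rewrite -tsum_yd; last by rewrite /f; lin.
  by rewrite /f; hom_simpl.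
- apply: tensor_ext; [lin | lin | move=> m n].
  hom_simpl.
  in_sums 1 (rewrite tsum_swap).
  rewrite tsum_coact_coassoc; last by lin.
  symmetry; in_sums 1 (rewrite tsum_swap).
  rewrite tsum_coact_coassoc; last by lin.
  symmetry.
  apply: eq_tsum => x m0.
  pose f u (v : N) := bi (bi u) ⊗ (v ⊗ m0).
  (* The braiding acts through two [b], and coassociativity has put a [bi] on the first leg; so the
     condition for [N] is used at [bi x] and [αi n]. *)
  transitivity (\tsum_(x1 ⊗ x2 <- hDelta (bi x))
    \tsum_(y ⊗ n0 <- yd_coact (yd_act (b (b x1)) (αi n))) f (hmul y x2) n0).
    by rewrite /f; hom_simpl.
  rewrite -tsum_yd; last by rewrite /f; lin.
  by rewrite /f; hom_simpl.
- apply: tensor_ext; [lin | lin | move=> m n].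
  by hom_simpl.
Qed.
End Morphisms.

(** * The inverse of the antipode and of the braiding *)

Section Antipode.
Context (K : fieldType) (H : homHopfAlgebra K).
Implicit Types (h k l : H) (W : lmodType K).
Local Notation b := (@hbeta K H).
Local Notation bi := (inv_map (@hbeta K H)).
Local Notation S := (@antipode K H).

Lemma tsum_antipodel W (f : H -> W) h : linear f ->
  \tsum_(h1 ⊗ h2 <- hDelta h) f (hmul (S h1) h2) = heps h *: f hone.
Proof. by move=> lf; rewrite -(linear_tsum _ _ lf) antipodel linear_mapZ. Qed.

Lemma tsum_antipoder W (f : H -> W) h : linear f ->
  \tsum_(h1 ⊗ h2 <- hDelta h) f (hmul h1 (S h2)) = heps h *: f hone.
Proof. by move=> lf; rewrite -(linear_tsum _ _ lf) antipoder linear_mapZ. Qed.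

Lemma antipode_betai h : S (bi h) = bi (S h).
Proof. by rewrite -{2}[h]hbetaiK antipode_beta hbetaK. Qed.

Lemma antipode1 : S hone = hone.
Proof.
apply: (can_inj (@hbetaK K H)); rewrite -hmulh1 hbeta1.
have := antipodel (hone : H).
by rewrite tsum_Delta1 ?heps1 ?scale1r //; lin.
Qed.

(** [h ⊗ k |-> S k S h] is a right convolution inverse of the multiplication: reassociating exposes
    [k1 S k2], and once this has collapsed, [h1 S h2]. *)
Lemma tsum_conv_antipodeM W (f : H -> W) h k : linear f ->
  \tsum_(h1 ⊗ h2 <- hDelta h) \tsum_(k1 ⊗ k2 <- hDelta k)
    f (hmul (hmul h1 k1) (hmul (S k2) (S h2))) =
  heps h *: (heps k *: f hone).
Proof.
move=> lf.
transitivity (\tsum_(h1 ⊗ h2 <- hDelta h) \tsum_(k1 ⊗ k2 <- hDelta k)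
    f (hmul (b h1) (hmul (bi (hmul k1 (S k2))) (S h2)))).
  by do 2 apply: eq_tsum => ? ?; rewrite !hom_simp.
transitivity (\tsum_(h1 ⊗ h2 <- hDelta h) heps k *: f (b (hmul h1 (S h2)))).
  apply: eq_tsum => h1 h2.
  rewrite (tsum_antipoder (f := fun u => f (hmul (b h1) (hmul (bi u) (S h2)))));
    last by lin.
  by rewrite !hom_simp.
rewrite (tsum_antipoder (f := fun u => heps k *: f (b u))); last by lin.
by rewrite hbeta1.
Qed.

(* The convolution product of [h ⊗ k |-> S (h k)], [h ⊗ k |-> h k] and
   [h ⊗ k |-> S k S h] is evaluated in two ways. *)
Lemma antipodeM h k : S (hmul h k) = hmul (S k) (S h).
Proof.
(* Each evaluation yields a fourth power of [b]. In the first, two are built into the summand, one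
   comes from multiplying by [hone], and one from the counit laws, since [b h] times [b k] is
   [b (h k)]. *)
do 4 apply: (can_inj (@hbetaK K H)).
transitivity (\tsum_(h1 ⊗ h2 <- hDelta h) \tsum_(k1 ⊗ k2 <- hDelta k)
   \tsum_(h21 ⊗ h22 <- hDelta h2) \tsum_(k21 ⊗ k22 <- hDelta k2)
     hmul (b (b (S (hmul h1 k1))))
          (hmul (hmul h21 k21) (hmul (S k22) (S h22)))).
  transitivity (\tsum_(h1 ⊗ h2 <- hDelta h) \tsum_(k1 ⊗ k2 <- hDelta k)
      heps h2 *: (heps k2 *: b (b (b (S (hmul h1 k1)))))).
    transitivity (\tsum_(h1 ⊗ h2 <- hDelta h)
       heps h2 *: b (b (b (S (hmul h1 (b k)))))).
      rewrite tsum_Delta_epsr; last by lin.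
      by rewrite -hbetaM antipode_beta.
    apply: eq_tsum => h1 h2.
    rewrite -(linear_tsum _ _ (linear_scaler _ (@linear_id _ _))).
    by rewrite tsum_Delta_epsr; last by lin.
  do 2 apply: eq_tsum => ? ?; rewrite tsum_conv_antipodeM; last by lin.
  by rewrite hmulh1.
in_sums 1 (rewrite tsum_swap).
rewrite tsum_coassoc; last by lin.
in_sums 2 (rewrite tsum_coassoc; last by lin).
transitivity (\tsum_(h1 ⊗ h2 <- hDelta h) \tsum_(k1 ⊗ k2 <- hDelta k)
   \tsum_(x ⊗ y <- hDelta (hmul h1 k1))
     hmul (hmul (S x) y) (b (b (hmul (S k2) (S h2))))).
  apply: eq_tsum => h1 h2; rewrite tsum_swap; apply: eq_tsum => k1 k2.
  rewrite tsum_DeltaM; last by lin.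
  do 2 apply: eq_tsum => ? ?.
  by rewrite -hbetaiM antipode_betai !antipode_beta !hom_simp.
transitivity (\tsum_(h1 ⊗ h2 <- hDelta h) \tsum_(k1 ⊗ k2 <- hDelta k)
   heps h1 *: (heps k1 *: b (b (b (hmul (S k2) (S h2)))))).
  do 2 apply: eq_tsum => ? ?.
  rewrite (tsum_antipodel (f := fun u => hmul u _)); last by lin.
  by rewrite heps_hmulZ hmul1h.
transitivity (\tsum_(h1 ⊗ h2 <- hDelta h)
   heps h1 *: b (b (b (hmul (S (b k)) (S h2))))).
  apply: eq_tsum => h1 h2.
  rewrite -(linear_tsum _ _ (linear_scaler _ (@linear_id _ _))).
  by rewrite tsum_Delta_epsl; last by lin.
rewrite tsum_Delta_epsl; last by lin.
by rewrite !antipode_beta -hbetaM.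
Qed.

Hypothesis S_bij : bijective S.
Local Notation T := (inv_map S).

Lemma linear_antipodei : linear T.
Proof. exact: linear_inv_map (@antipode_linear _ _) S_bij. Qed.

Lemma antipodei_beta h : T (b h) = b (T h).
Proof. by apply: (bij_inj S_bij); rewrite antipode_beta !inv_mapKV. Qed.

Lemma antipodeiM h k : T (hmul h k) = hmul (T k) (T h).
Proof. by apply: (bij_inj S_bij); rewrite antipodeM !inv_mapKV. Qed.

Lemma antipodei1 : T hone = hone.
Proof. by apply: (bij_inj S_bij); rewrite antipode1 inv_mapKV. Qed.

Lemma tsum_antipodeil W (f : H -> W) h : linear f ->
  \tsum_(h1 ⊗ h2 <- hDelta h) f (hmul (T h2) h1) = heps h *: f hone.
Proof.
move=> lf; have lT := linear_antipodei.
rewrite -antipodei1 -(tsum_antipodel (f := fun u => f (T u))); last by lin.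
by apply: eq_tsum => h1 h2; rewrite antipodeiM inv_mapK.
Qed.

Lemma tsum_antipodeir W (f : H -> W) h : linear f ->
  \tsum_(h1 ⊗ h2 <- hDelta h) f (hmul h2 (T h1)) = heps h *: f hone.
Proof.
move=> lf; have lT := linear_antipodei.
rewrite -antipodei1 -(tsum_antipoder (f := fun u => f (T u))); last by lin.
by apply: eq_tsum => h1 h2; rewrite antipodeiM inv_mapK.
Qed.

Section Braiding.
Context (M N : ydModule H).
Local Notation α := (@yd_alpha K H _).
Local Notation αi := (inv_map (@yd_alpha K H _)).

Definition braidi_fun (t : tensor N M) : tensor M N :=
  \tsum_(n ⊗ m <- t) \tsum_(x ⊗ m0 <- yd_coact m)
    αi m0 ⊗ yd_act (T (b (b x))) (αi n).

Lemma braid_funK : cancel (@braid_fun K H M N) braidi_fun.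
Proof.
have lT := linear_antipodei; rewrite /braid_fun /braidi_fun.
apply: tensor_ext; [lin | lin | move=> m n].
hom_lhs; rewrite tsum_coact_coassoc; last by lin.
transitivity (\tsum_(x ⊗ m0 <- yd_coact m) heps x *: (αi m0 ⊗ n)).
  apply: eq_tsum => x m0.
  (* Writes [n] as [hone ▷ αi n], the value at [hone] of the linear map to which the law for [T] is
     applied. *)
  rewrite -[n in RHS]alphaiK -[α (αi n)]act1m.
  rewrite -(tsum_antipodeil (f := fun u => αi m0 ⊗ yd_act u (αi n)));
    last by lin.
  by apply: eq_tsum => x1 x2; rewrite !antipodei_beta !hom_simp.
by rewrite tsum_coact_eps ?alphaK; last by lin.
Qed.

Lemma braidi_funK : cancel braidi_fun (@braid_fun K H M N).
Proof.
have lT := linear_antipodei; rewrite /braid_fun /braidi_fun.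
apply: tensor_ext; [lin | lin | move=> n m].
hom_lhs; rewrite tsum_coact_coassoc; last by lin.
transitivity (\tsum_(x ⊗ m0 <- yd_coact m) heps x *: (n ⊗ αi m0)).
  apply: eq_tsum => x m0.
  rewrite -[n in RHS]alphaiK -[α (αi n)]act1m.
  rewrite -(tsum_antipodeir (f := fun u => yd_act u (αi n) ⊗ αi m0));
    last by lin.
  by apply: eq_tsum => x1 x2; rewrite !hom_simp antipodei_beta hbetaK.
by rewrite tsum_coact_eps ?alphaK; last by lin.
Qed.

Definition yd_braid :=
  @yd_iso K H (yd_tensor M N) (yd_tensor N M)
    (YDHom (braid_is_morphism M N)) _ braid_funK braidi_funK.

End Braiding.
End Antipode.

(** * Coherence *)

Section Coherence.
Context (K : fieldType) (H : homHopfAlgebra K).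
Hypothesis S_bij : bijective (@antipode K H).
Local Notation hom := Defs.hom.
Implicit Types M N P Q : YD H.

Lemma yd_ext2 (M N P : ydModule H) (f g : ydHom (yd_tensor M N) P) :
  (forall m n, f (m ⊗ n) = g (m ⊗ n)) -> f = g.
Proof.
move=> e; apply: ydHom_ext; apply: tensor_ext e.
  exact: (linear_ydhom f).
exact: (linear_ydhom g).
Qed.

Lemma yd_ext3 (M N P Q : ydModule H)
    (f g : ydHom (yd_tensor (yd_tensor M N) P) Q) :
  (forall m n p, f (m ⊗ n ⊗ p) = g (m ⊗ n ⊗ p)) -> f = g.
Proof.
have lf := linear_ydhom f; have lg := linear_ydhom g.
move=> e; apply: yd_ext2 => s p; move: s.
by apply: tensor_ext; [lin | lin | move=> m n].
Qed.

Lemma yd_ext3r (M N P Q : ydModule H)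
    (f g : ydHom (yd_tensor M (yd_tensor N P)) Q) :
  (forall m n p, f (m ⊗ (n ⊗ p)) = g (m ⊗ (n ⊗ p))) -> f = g.
Proof.
have lf := linear_ydhom f; have lg := linear_ydhom g.
move=> e; apply: yd_ext2 => m.
by apply: tensor_ext; [lin | lin | move=> n p].
Qed.

Lemma yd_ext4 (M N P R Q : ydModule H)
    (f g : ydHom (yd_tensor (yd_tensor (yd_tensor M N) P) R) Q) :
  (forall m n p r, f (m ⊗ n ⊗ p ⊗ r) = g (m ⊗ n ⊗ p ⊗ r)) -> f = g.
Proof.
have lf := linear_ydhom f; have lg := linear_ydhom g.
move=> e; apply: yd_ext2 => s r; move: s.
apply: tensor_ext; [lin | lin | move=> s p]; move: s.
by apply: tensor_ext; [lin | lin | move=> m n].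
Qed.

Lemma yd_tmap1 M N : yd_tmap (idm M) (idm N) = idm (yd_tensor M N : YD H).
Proof. by apply: yd_ext2 => m n; rewrite yd_tmapE. Qed.

Lemma yd_tmapM M M' M'' N N' N'' (f' : hom M' M'') (f : hom M M')
    (g' : hom N' N'') (g : hom N N') :
  yd_tmap (f' \oc f) (g' \oc g) =
  yd_tmap f' g' \oc yd_tmap f g.
Proof. by apply: yd_ext2 => m n; rewrite yd_tmapE [RHS]/=; hom_rhs. Qed.

Lemma yd_assoc_natural M M' N N' P P' (f : hom M M') (g : hom N N')
    (h : hom P P') :
  yd_assoc M' N' P' \oc yd_tmap (yd_tmap f g) h =
  yd_tmap f (yd_tmap g h) \oc yd_assoc M N P.
Proof.
apply: yd_ext3 => m n p /=; rewrite /assoc_fun; hom_simpl.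
by rewrite ydHom_alphai (ydhom_alpha (ydhomP h)).
Qed.

Lemma yd_lunit_natural M M' (f : hom M M') :
  yd_lunit M' \oc yd_tmap (idm (yd_unit H : YD H)) f = f \oc yd_lunit M.
Proof.
apply: yd_ext2 => k m; rewrite [LHS]/= tsum_tens ?lunit_funE; last by lin.
by rewrite /= lunit_funE (linear_mapZ _ _ (linear_ydhom f)) ydHom_alphai.
Qed.

Lemma yd_runit_natural M M' (f : hom M M') :
  yd_runit M' \oc yd_tmap f (idm (yd_unit H : YD H)) = f \oc yd_runit M.
Proof.
apply: yd_ext2 => m k; rewrite [LHS]/= tsum_tens ?runit_funE; last by lin.
by rewrite /= runit_funE (linear_mapZ _ _ (linear_ydhom f)) ydHom_alphai.
Qed.

Lemma yd_pentagon M N P Q :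
  yd_assoc M N (yd_tensor P Q) \oc yd_assoc (yd_tensor M N) P Q =
  yd_tmap (idm M) (yd_assoc N P Q)
    \oc yd_assoc M (yd_tensor N P) Q
    \oc yd_tmap (yd_assoc M N P) (idm Q).
Proof.
apply: yd_ext4 => m n p q /=; rewrite /assoc_fun; hom_simpl.
(* The remaining twists belong to tensor product objects, and normalization does not split them over
   the factors. *)
by rewrite tensor_alphaiE tensor_alphaE; hom_lhs.
Qed.

Lemma yd_triangle M N :
  yd_tmap (idm M) (yd_lunit N)
    \oc yd_assoc M (yd_unit H) N =
  yd_tmap (yd_runit M) (idm N).
Proof.
have ll := @linear_lunit_fun K H N; have lr := @linear_runit_fun K H M.
apply: yd_ext3 => m k n /=.
rewrite assoc_funE !tsum_tens; [| lin | lin].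
rewrite lunit_funE runit_funE alphaK.
rewrite (linear_mapZ _ _ (linear_tensr _)).
by rewrite -(linear_mapZ _ _ (linear_tensl _)).
Qed.

Lemma yd_braid_natural M M' N N' (f : hom M M') (g : hom N N') :
  yd_braid S_bij M' N' \oc yd_tmap f g =
  yd_tmap g f \oc yd_braid S_bij M N.
Proof.
apply: yd_ext2 => m n /=; rewrite /braid_fun; hom_simpl.
rewrite tsum_coact_ydhom; last by lin.
by apply: eq_tsum => x m0; rewrite (ydhom_act (ydhomP g)) !ydHom_alphai.
Qed.

(** The diagonal action on [N ⊗ P] splits the coaction leg of [m] by [hDelta], while two successive
    braidings coact on [m] twice; coassociativity of the coaction identifies the two. *)
Lemma yd_hexagon1 M N P :
  yd_assoc N P M \oc yd_braid S_bij M (yd_tensor N P) \oc yd_assoc M N P =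
  yd_tmap (idm N) (yd_braid S_bij M P)
    \oc yd_assoc N M P \oc yd_tmap (yd_braid S_bij M N) (idm P).
Proof.
apply: yd_ext3 => m n p /=; rewrite /braid_fun /assoc_fun; hom_simpl.
rewrite tensor_alphaiE; in_sums 1 (rewrite tensor_actE).
symmetry; rewrite tsum_coact_coassoc; last by lin.
by hom_simpl.
Qed.

(** The coaction leg of [m ⊗ n] is a product, and acting by a product on [p] is acting twice.
    Normalization merges the two actions, which leaves only the order of the sums. *)
Lemma yd_hexagon2 M N P :
  iso_inv (yd_assoc P M N) \oc yd_braid S_bij (yd_tensor M N) P
    \oc iso_inv (yd_assoc M N P) =
  yd_tmap (yd_braid S_bij M P) (idm N)
    \oc iso_inv (yd_assoc M P N) \oc yd_tmap (idm M) (yd_braid S_bij N P).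
Proof.
apply: yd_ext3r => m n p /=; rewrite /braid_fun /associ_fun; hom_simpl.
rewrite tensor_coactE; hom_lhs.
in_sums 2 (rewrite tensor_alphaiE).
hom_lhs.
by rewrite tsum_swap.
Qed.

Definition yd_braided_tensor_structure :
    braided_tensor_structure (fun M N : YD H => yd_tensor M N : YD H)
      (yd_unit H) :=
  @BraidedTensorStructure (YD H) (@yd_tensor K H) (yd_unit H) (@yd_tmap K H)
    yd_tmap1 yd_tmapM (@yd_assoc K H) yd_assoc_natural
    (@yd_lunit K H) yd_lunit_natural (@yd_runit K H) yd_runit_natural
    yd_pentagon yd_triangle (@yd_braid K H S_bij) yd_braid_natural
    yd_hexagon1 yd_hexagon2.

End Coherence.

(** The data of the tensor product and of the unit object are fixed on the nose; for these objects
    only the proofs of [is_yd] are existential. Of the structure [B], the three clauses leave open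
    only the unit constraints. *)
Theorem theorem4p7 (K : fieldType) (H : homHopfAlgebra K)
    (S_bij : bijective (@antipode K H)) :
  exists (tensor_yd : forall M N : ydModule H, is_yd (yd_tensor_data M N))
         (unit_yd : is_yd (yd_unit_data H))
         (B : @braided_tensor_structure (YD H)
                (fun M N : ydModule H => YDModule (tensor_yd M N))
                (YDModule unit_yd)),
    [/\ (* tensor product of morphisms *)
        forall (M M' N N' : ydModule H) (f : ydHom M M') (g : ydHom N N')
               (m : M) (n : N),
          (tmap B f g : ydHom _ _) (m ⊗ n) = f m ⊗ g n,
        (* associativity constraints *)
        forall (M N P : ydModule H) (m : M) (n : N) (p : P),
          (iso_fwd (assoc B M N P) : ydHom _ _) ((m ⊗ n) ⊗ p) =
          inv_map (@yd_alpha K H M) m ⊗ (n ⊗ yd_alpha p) &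
        (* braiding *)
        forall (M N : ydModule H) (m : M) (n : N),
          (iso_fwd (braid B M N) : ydHom _ _) (m ⊗ n) =
          \tsum_(x ⊗ m0 <- yd_coact m)
            yd_act (iter 2 (@hbeta K H) x) (inv_map (@yd_alpha K H N) n)
              ⊗ inv_map (@yd_alpha K H M) m0].
Proof.
exists (@tensor_is_yd K H), (unit_is_yd H), (yd_braided_tensor_structure S_bij).
split=> [M M' N N' f g m n | M N P m n p | M N m n].
- exact: yd_tmapE.
- exact: assoc_funE.
- exact: braid_funE.
Qed.
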